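(* Let $a<b$ be real numbers and let $\{M_n\}_{n\in\mathbb{N}}$ be an arbitrary sequence of positive real numbers such that $$\limsup_{n\to+\infty}M_n^{\frac1n}=+\infty.$$ Then there exist an increasing, divergent sequence of positive integers $\{d_n\}_{n\in\mathbb{N}}$ and a real-valued function $f\in C^\infty([a,b])$ such that, for some $K>0$, $$\max_{x\in[a,b]}|f^{(d_n)}(x)|\le K^{d_n+1}M_{d_n}\qquad\text{for every } n\in\mathbb{N},$$ but $f\notin C^M([a,b])$.
   Context: $\mathbb{N}$ denotes the set of non-negative integers. $C^\infty([a,b])$ is the set of smooth functions on the closed interval $[a,b]$. For a sequence $M=\{M_n\}_{n\in\mathbb{N}}$ of positive numbers, the Denjoy-Carleman class is $$C^M([a,b])=\{f\in C^\infty([a,b]) : \exists K>0 \text{ such that } |f^{(n)}(x)|\le K^{n+1}M_n \text{ for all } x\in[a,b],\ n=0,1,2,\ldots\}.$$ *)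

(* Defs.v *)
(* Stdlib reals, with Coquelicot for the limit superior of a sequence. *)
From Stdlib Require Import Reals ClassicalEpsilon.
From Coquelicot Require Import Coquelicot.
Open Scope R_scope.

Definition segment (a b x : R) : Prop := a <= x <= b.

(* A function on [a,b] is represented by a total function R -> R, of which
   only the values on [a,b] matter: derivatives are taken relative to [a,b],
   hence are one-sided at a and at b. *)
Definition derivable_on_at (a b : R) (f : R -> R) (x : R) : Prop :=
  exists l : R, D_in f (fun _ => l) (segment a b) x.

(* Unspecified where the relative derivative does not exist; for a < b and x in
   [a,b], it is unique when it exists. *)
Definition derive_on (a b : R) (f : R -> R) (x : R) : R :=
  epsilon (inhabits 0) (fun l => D_in f (fun _ => l) (segment a b) x).

Fixpoint derive_n_on (a b : R) (n : nat) (f : R -> R) : R -> R :=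
  match n with
  | O => f
  | S m => derive_on a b (derive_n_on a b m f)
  end.

Definition smooth_on (a b : R) (f : R -> R) : Prop :=
  forall (n : nat) (x : R), segment a b x ->
    derivable_on_at a b (derive_n_on a b n f) x.

Definition Denjoy_Carleman (M : nat -> R) (a b : R) (f : R -> R) : Prop :=
  smooth_on a b f /\
  exists K : R, 0 < K /\
    forall (x : R) (n : nat), segment a b x ->
      Rabs (derive_n_on a b n f x) <= K ^ (n + 1) * M n.

Definition is_max_on (a b : R) (g : R -> R) (m : R) : Prop :=
  (exists x : R, segment a b x /\ g x = m) /\
  (forall x : R, segment a b x -> g x <= m).

(* Main.v *)
(* If M_d^(1/d) is huge at d, an exponential of frequency M_d^(1/d) may have
   bounded derivatives up to some order d' < d and yet a derivative of order
   d' + 1 far larger than M_(d'+1), while its derivative of order d remains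
   below M_d.  Hence one chooses d_0 < d_1 < ... so sparse that
   l_n = M_(d_(n+1))^(1/d_(n+1)) increases and exceeds
   2^n (n+1)^(d_n+2) M_(d_n+1), and takes
     f(x) = sum_n 2^(-n) l_n^(-d_n) exp(l_n (x - b)).
   All derivatives are positive on [a,b] and largest at b, so that both bounds
   are read off from the coefficients of the series at b. *)
Require Import Defs.
From Stdlib Require Import Reals Lra Lia ClassicalEpsilon.
From Coquelicot Require Import Coquelicot.
Open Scope R_scope.

(** * Tangent estimates and derivatives relative to a segment *)

Lemma exp_tangent_error (u v : R) :
  u <= 0 -> v <= 0 -> Rabs (exp v - exp u - (v - u) * exp u) <= (v - u) ^ 2.
Proof.
  assert (tangent : forall s t, (t - s) * exp s <= exp t - exp s).
  { intros s t.
    replace (exp t) with (exp s * exp (t - s)) by (rewrite <- exp_plus; f_equal; ring).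
    assert (H := exp_ineq1_le (t - s)).
    assert (H' := exp_pos s). nra. }
  assert (le1 : forall s, s <= 0 -> exp s <= 1).
  { intros s [Hs | ->].
    - apply Rlt_le. rewrite <- exp_0. now apply exp_increasing.
    - rewrite exp_0. lra. }
  intros Hu Hv.
  (* The tangent at [u] makes the error nonnegative; the tangent at [v] bounds it by
     [(v - u) * (exp v - exp u)]. As [exp] is at most 1 on the nonpositive reals, it is 1-Lipschitz
     there. *)
  assert (Huv := tangent u v). assert (Hvu := tangent v u).
  assert (Hu1 := le1 u Hu). assert (Hv1 := le1 v Hv).
  assert (Pu := exp_pos u). assert (Pv := exp_pos v).
  rewrite Rabs_pos_eq by lra.
  destruct (Rle_dec u v); nra.
Qed.

(** Since [a < b], each point of the segment is a limit of others, taken on its right if [x < b] and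
    on its left otherwise, so limits of difference quotients are unique. *)
Lemma D_in_segment_unique (a b : R) (g1 g2 : R -> R) (x l1 l2 : R) :
  a < b -> segment a b x -> (forall y, segment a b y -> g1 y = g2 y) ->
  D_in g1 (fun _ => l1) (segment a b) x ->
  D_in g2 (fun _ => l2) (segment a b) x -> l1 = l2.
Proof.
  intros hab Hx Hg H1 H2.
  assert (Hadh : adhDa (D_x (segment a b) x) x).
  { intros e He. unfold segment in *. unfold Rdist, D_x.
    destruct (Rlt_dec x b).
    - exists (x + Rmin (e / 2) (b - x)).
      assert (Rmin (e / 2) (b - x) <= e / 2) by apply Rmin_l.
      assert (Rmin (e / 2) (b - x) <= b - x) by apply Rmin_r.
      assert (0 < Rmin (e / 2) (b - x)) by (apply Rmin_glb_lt; lra).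
      repeat split; try lra. rewrite Rabs_pos_eq; lra.
    - exists (x - Rmin (e / 2) (x - a)).
      assert (Rmin (e / 2) (x - a) <= e / 2) by apply Rmin_l.
      assert (Rmin (e / 2) (x - a) <= x - a) by apply Rmin_r.
      assert (0 < Rmin (e / 2) (x - a)) by (apply Rmin_glb_lt; lra).
      repeat split; try lra. rewrite Rabs_left; lra. }
  eapply single_limit; [exact Hadh | exact H1 |].
  intros e He. destruct (H2 e He) as [al [Hal H]].
  exists al. split; [exact Hal |].
  intros y [Hy Hd]. rewrite !Hg; [now apply H | assumption | apply Hy].
Qed.

(** Pins down the value picked by [epsilon]. Agreement on the segment alone is what an induction
    over [derive_n_on] can supply. *)
Lemma derive_on_eq (a b : R) (g h : R -> R) (x l : R) :
  a < b -> segment a b x -> (forall y, segment a b y -> g y = h y) ->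
  D_in h (fun _ => l) (segment a b) x ->
  D_in g (fun _ => l) (segment a b) x /\ derive_on a b g x = l.
Proof.
  intros hab Hx Hgh Hh.
  assert (Hg : D_in g (fun _ => l) (segment a b) x).
  { intros e He. destruct (Hh e He) as [al [Hal H]].
    exists al. split; [exact Hal |].
    intros y [Hy Hd]. rewrite !Hgh; [now apply H | assumption | apply Hy]. }
  split; [exact Hg |].
  apply (D_in_segment_unique a b g g x); try easy.
  unfold derive_on.
  apply (epsilon_spec (inhabits 0) (fun l => D_in g (fun _ => l) (segment a b) x)).
  now exists l.
Qed.

(** Remainder bounds of this form can be summed, so a series can be differentiated termwise without
    an appeal to uniform convergence. *)
Lemma D_in_quadratic_error (D : R -> Prop) (g : R -> R) (x l C : R) :
  (forall y, D y -> Rabs (g y - g x - (y - x) * l) <= C * (y - x) ^ 2) ->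
  D_in g (fun _ => l) D x.
Proof.
  intros H e He.
  assert (HC : 0 < Rabs C + 1) by (assert (H' := Rabs_pos C); lra).
  exists (e / (Rabs C + 1)). split; [now apply Rdiv_lt_0_compat |].
  intros y [[Dy Hne] Hd]. simpl in Hd |- *. unfold Rdist in *.
  specialize (H y Dy).
  assert (Hyx : y - x <> 0) by lra.
  assert (Hp : 0 < Rabs (y - x)) by now apply Rabs_pos_lt.
  replace ((g y - g x) / (y - x) - l) with ((g y - g x - (y - x) * l) / (y - x))
    by now field.
  rewrite Rabs_div by exact Hyx.
  apply Rmult_lt_reg_r with (Rabs (y - x)); [exact Hp |].
  unfold Rdiv. rewrite Rmult_assoc, Rinv_l, Rmult_1_r by lra.
  apply Rle_lt_trans with (1 := H).
  rewrite <- (pow2_abs (y - x)).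
  apply (Rmult_lt_compat_r (Rabs C + 1)) in Hd; [| exact HC].
  unfold Rdiv in Hd. rewrite Rmult_assoc, Rinv_l, Rmult_1_r in Hd by lra.
  assert (H' := Rle_abs C). nra.
Qed.

(** * Series of exponentials with nonnegative coefficients *)

Lemma Series_ge_term (u : nat -> R) (n : nat) :
  (forall k, 0 <= u k) -> ex_series u -> u n <= Series u.
Proof.
  intros Hu Hex. apply Rle_trans with (sum_n u n).
  - destruct n; [rewrite sum_O; lra |].
    rewrite sum_Sn. change (u (S n) <= sum_n u n + u (S n)).
    assert (0 <= sum_n u n); [| lra].
    rewrite sum_n_Reals. now apply cond_pos_sum.
  - apply (is_lim_seq_incr_compare (sum_n u)).
    + apply Series_correct, Hex.
    + intros m. rewrite sum_Sn. change (sum_n u m <= sum_n u m + u (S m)).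
      specialize (Hu (S m)). lra.
Qed.

(** The formal termwise derivative of order [k]. Centring at [b] keeps each exponential at most 1 on
    the segment when the frequencies are nonnegative. *)
Definition exp_series (b : R) (c l : nat -> R) (k : nat) (x : R) : R :=
  Series (fun n => c n * l n ^ k * exp (l n * (x - b))).

Section ExpSeries.

Variables (a b : R) (c l : nat -> R).
Hypothesis hab : a < b.
Hypothesis hc : forall n, 0 <= c n.
Hypothesis hl : forall n, 0 <= l n.
Hypothesis hsum : forall k, ex_series (fun n => c n * l n ^ k).

Lemma exp_series_coef_pos (k n : nat) : 0 <= c n * l n ^ k.
Proof. apply Rmult_le_pos; [apply hc | apply pow_le, hl]. Qed.

Lemma exp_series_term_bounds (k n : nat) (x : R) : x <= b ->
  0 <= c n * l n ^ k * exp (l n * (x - b)) <= c n * l n ^ k.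
Proof.
  intros Hx. assert (H := exp_series_coef_pos k n).
  assert (Hn := hl n).
  assert (He : exp (l n * (x - b)) <= 1).
  { destruct (Rle_lt_or_eq_dec (l n * (x - b)) 0) as [Hs | ->]; [nra | |].
    - apply Rlt_le. rewrite <- exp_0. now apply exp_increasing.
    - rewrite exp_0. lra. }
  assert (Hp := exp_pos (l n * (x - b))). split; nra.
Qed.

Lemma ex_exp_series (k : nat) (x : R) : x <= b ->
  ex_series (fun n => c n * l n ^ k * exp (l n * (x - b))).
Proof.
  intros Hx.
  apply (ex_series_le (V := R_CompleteNormedModule)) with (2 := hsum k).
  intros n. change (Rabs (c n * l n ^ k * exp (l n * (x - b))) <= c n * l n ^ k).
  destruct (exp_series_term_bounds k n x Hx). now rewrite Rabs_pos_eq.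
Qed.

Lemma exp_series_at_end (k : nat) :
  exp_series b c l k b = Series (fun n => c n * l n ^ k).
Proof.
  apply Series_ext. intros n.
  now rewrite Rminus_diag, Rmult_0_r, exp_0, Rmult_1_r.
Qed.

Lemma exp_series_bounds (k : nat) (x : R) : x <= b ->
  0 <= exp_series b c l k x <= exp_series b c l k b.
Proof.
  intros Hx. rewrite exp_series_at_end. split.
  - assert (Hpos := fun n => proj1 (exp_series_term_bounds k n x Hx)).
    apply Rle_trans with (1 := Hpos O).
    exact (Series_ge_term _ O Hpos (ex_exp_series k x Hx)).
  - apply Series_le; [| apply hsum].
    intros n. now apply exp_series_term_bounds.
Qed.

Lemma exp_series_D_in (k : nat) (x : R) : x <= b ->
  D_in (exp_series b c l k) (fun _ => exp_series b c l (S k) x) (segment a b) x.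
Proof.
  intros Hx.
  (* The tangent error with [u = l n * (x - b)] and [v = l n * (y - b)] is at most
     [l n ^ 2 * (y - x) ^ 2]: two more powers of [l n], hence the series of order [k + 2]. *)
  apply D_in_quadratic_error with (C := Series (fun n => c n * l n ^ S (S k))).
  intros y [_ Hy]. unfold exp_series.
  rewrite <- Series_minus by now apply ex_exp_series.
  rewrite <- Series_scal_l.
  rewrite <- Series_minus.
  2:{ apply (ex_series_minus (V := R_NormedModule)); now apply ex_exp_series. }
  2:{ apply (ex_series_scal (V := R_NormedModule)); now apply ex_exp_series. }
  rewrite <- Series_scal_r.
  assert (Hbd : forall n : nat,
    Rabs (c n * l n ^ k * exp (l n * (y - b)) - c n * l n ^ k * exp (l n * (x - b))
          - (y - x) * (c n * l n ^ S k * exp (l n * (x - b))))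
    <= c n * l n ^ S (S k) * (y - x) ^ 2).
  { intros n. assert (Hn := hl n).
    assert (He := exp_tangent_error (l n * (x - b)) (l n * (y - b))
                    ltac:(nra) ltac:(nra)).
    apply (Rmult_le_compat_l _ _ _ (exp_series_coef_pos k n)) in He.
    rewrite <- (Rabs_pos_eq _ (exp_series_coef_pos k n)) in He at 1.
    rewrite <- Rabs_mult in He.
    eapply Rle_trans; [eapply Rle_trans; [| exact He] |].
    - right. f_equal. simpl. ring.
    - right. simpl. ring. }
  assert (Hex : ex_series (fun n => c n * l n ^ S (S k) * (y - x) ^ 2)).
  { apply ex_series_scal_r, hsum. }
  eapply Rle_trans; [apply Series_Rabs |].
  - apply (ex_series_le (V := R_CompleteNormedModule)) with (2 := Hex).
    intros n. change (Rabs (Rabs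
      (c n * l n ^ k * exp (l n * (y - b)) - c n * l n ^ k * exp (l n * (x - b))
          - (y - x) * (c n * l n ^ S k * exp (l n * (x - b)))))
       <= c n * l n ^ S (S k) * (y - x) ^ 2).
    rewrite Rabs_Rabsolu. apply Hbd.
  - apply Series_le with (2 := Hex). intros n. split; [apply Rabs_pos | apply Hbd].
Qed.

Lemma derive_n_on_exp_series (k : nat) (x : R) : segment a b x ->
  derive_n_on a b k (exp_series b c l 0) x = exp_series b c l k x.
Proof.
  revert x. induction k as [| k IH]; intros x Hx; [reflexivity |].
  apply (derive_on_eq a b _ (exp_series b c l k)); [exact hab | exact Hx | exact IH |].
  apply exp_series_D_in, Hx.
Qed.

Lemma smooth_on_exp_series : smooth_on a b (exp_series b c l 0).
Proof.
  intros k x Hx. exists (exp_series b c l (S k) x).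
  apply (derive_on_eq a b _ (exp_series b c l k)); [exact hab | exact Hx | |].
  - intros y. apply derive_n_on_exp_series.
  - apply exp_series_D_in, Hx.
Qed.

Lemma is_max_on_derive_n_exp_series (k : nat) :
  is_max_on a b (fun x => Rabs (derive_n_on a b k (exp_series b c l 0) x))
    (Series (fun n => c n * l n ^ k)).
Proof.
  assert (Hb : segment a b b) by (unfold segment; lra).
  rewrite <- exp_series_at_end. split.
  - exists b. split; [exact Hb |].
    rewrite derive_n_on_exp_series by exact Hb.
    apply Rabs_pos_eq. apply exp_series_bounds. lra.
  - intros x Hx. rewrite derive_n_on_exp_series by exact Hx.
    destruct (exp_series_bounds k x) as [H0 H1]; [apply Hx |].
    now rewrite Rabs_pos_eq.
Qed.

End ExpSeries.

(** * Choice of the sparse indices *)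

Lemma is_series_half_pow (C : R) : is_series (fun n => C * (1 / 2) ^ n) (C * 2).
Proof.
  replace (C * 2) with (C * / (1 - 1 / 2)) by field.
  apply (is_series_scal (V := R_NormedModule) C).
  apply is_series_geom. rewrite Rabs_pos_eq; lra.
Qed.

(** An infinite limit superior yields, past any index, a value of [L] above any threshold; recursion
    lets the threshold depend on the index just chosen. *)
Lemma sparse_subsequence (L : nat -> R) (T : nat -> nat -> R) :
  LimSup_seq L = p_infty ->
  exists d : nat -> nat, (0 < d O)%nat /\ 1 < L (d O) /\
    forall n, (d n < d (S n))%nat /\ T n (d n) < L (d (S n)).
Proof.
  intros HL.
  assert (Hex : forall (N : nat) (t : R), {d : nat | (N < d)%nat /\ t < L d}).
  { intros N t. apply constructive_indefinite_description.
    assert (H := proj2_sig (ex_LimSup_seq L)). fold (LimSup_seq L) in H.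
    rewrite HL in H. destruct (H t (S N)) as [d [Hd Ht]].
    exists d. split; [lia | exact Ht]. }
  exists (nat_rect _ (proj1_sig (Hex O 1)) (fun n dn => proj1_sig (Hex dn (T n dn)))).
  repeat split.
  - apply (proj2_sig (Hex O 1)).
  - apply (proj2_sig (Hex O 1)).
  - simpl. apply (proj2_sig (Hex _ _)).
  - simpl. apply (proj2_sig (Hex _ _)).
Qed.

Lemma Rpower_inv_INR_pow (x : R) (n : nat) :
  0 < x -> (0 < n)%nat -> Rpower x (/ INR n) ^ n = x.
Proof.
  intros Hx Hn. rewrite <- Rpower_pow by apply exp_pos.
  rewrite Rpower_mult, Rinv_l, Rpower_1; [easy | easy |].
  apply not_0_INR. lia.
Qed.

(** * Construction of the function and both estimates *)

Theorem theorem2 (a b : R) (hab : a < b) (M : nat -> R)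
    (hM : forall n : nat, 0 < M n)
    (hlimsup : LimSup_seq (fun n : nat => Rpower (M n) (/ INR n)) = p_infty) :
  exists (d : nat -> nat) (f : R -> R),
    (forall n : nat, (0 < d n)%nat) /\
    (forall n : nat, (d n < d (S n))%nat) /\
    is_lim_seq (fun n : nat => INR (d n)) p_infty /\
    smooth_on a b f /\
    (exists K : R, 0 < K /\
      forall n : nat, exists m : R,
        is_max_on a b (fun x => Rabs (derive_n_on a b (d n) f x)) m /\
        m <= K ^ (d n + 1) * M (d n)) /\
    ~ Denjoy_Carleman M a b f.
Proof.
  destruct (sparse_subsequence _
    (* The first summand makes [L] increase along [d]; the second defeats the class bound at order
       [d n + 1]. The base [n + 1] keeps it positive at [n = 0]. *)
    (fun n e => Rpower (M e) (/ INR e) + 2 ^ n * (INR (n + 1) ^ (e + 2) * M (e + 1)%nat))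
    hlimsup) as (d & Hd0 & HL0 & Hnext).
  pose (L := fun n => Rpower (M (d n)) (/ INR (d n))).
  pose (l := fun n => L (S n)).
  assert (Hinc : forall n, (d n < d (S n))%nat) by apply Hnext.
  assert (Hmono : forall m n, (m <= n)%nat -> (d m <= d n)%nat).
  { intros m n. induction 1 as [| n _ IH]; [lia |]. specialize (Hinc n). lia. }
  assert (Hge : forall n, (n < d n)%nat).
  { induction n as [| n IH]; [exact Hd0 |]. specialize (Hinc n). lia. }
  assert (Hpos : forall n, 0 < 2 ^ n * (INR (n + 1) ^ (d n + 2) * M (d n + 1)%nat)).
  { intros n. repeat apply Rmult_lt_0_compat; try apply pow_lt; try apply hM; [lra |].
    apply lt_0_INR. lia. }
  assert (Hlbig : forall n, 2 ^ n * (INR (n + 1) ^ (d n + 2) * M (d n + 1)%nat) < l n).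
  { intros n. destruct (Hnext n) as [_ H].
    assert (HP : 0 < Rpower (M (d n)) (/ INR (d n))) by apply exp_pos.
    unfold l, L. lra. }
  assert (HLinc : forall m n, (m <= n)%nat -> L m <= L n).
  { intros m n. induction 1 as [| n _ IH]; [lra |].
    destruct (Hnext n) as [_ H]. specialize (Hpos n). unfold L in *. lra. }
  assert (HL1 : forall n, 1 <= L n).
  { intros n. assert (H := HLinc O n ltac:(lia)). unfold L in *. lra. }
  assert (HLpow : forall n, L n ^ d n = M (d n)).
  { intros n. apply Rpower_inv_INR_pow; [apply hM |]. specialize (Hge n). lia. }
  assert (Hl1 : forall n, 1 <= l n) by (intros n; apply HL1).
  pose (c := fun n => (1 / 2) ^ n * / l n ^ d n).
  assert (Hhalf : forall n, 0 < (1 / 2) ^ n) by (intros n; apply pow_lt; lra).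
  assert (Hlpow : forall n k, 0 < l n ^ k).
  { intros n k. apply pow_lt. specialize (Hl1 n). lra. }
  assert (Hc : forall n, 0 <= c n).
  { intros n. apply Rmult_le_pos; apply Rlt_le; [apply Hhalf |].
    apply Rinv_0_lt_compat, Hlpow. }
  assert (Hl0 : forall n, 0 <= l n) by (intros n; specialize (Hl1 n); lra).
  (* If [m <= n], then [l n ^ d m <= l n ^ d n] and [M (d m) = L m ^ d m >= 1]. If [n < m], then
     [l n = L (S n) <= L m], so [l n ^ d m <= M (d m)], while [l n ^ d n >= 1]. *)
  assert (Hbound : forall m n, c n * l n ^ d m <= M (d m) * (1 / 2) ^ n).
  { intros m n.
    assert (H : l n ^ d m <= M (d m) * l n ^ d n).
    { rewrite <- HLpow. destruct (Nat.le_gt_cases m n) as [Hmn | Hmn].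
      - assert (H1 : 1 <= L m ^ d m) by apply pow_R1_Rle, HL1.
        assert (H2 : l n ^ d m <= l n ^ d n) by (apply Rle_pow; auto).
        specialize (Hlpow n (d n)). nra.
      - assert (H1 : 1 <= l n ^ d n) by apply pow_R1_Rle, Hl1.
        assert (H2 : l n ^ d m <= L m ^ d m).
        { apply pow_incr. split; [apply Hl0 |]. apply HLinc. lia. }
        assert (H3 : 1 <= L m ^ d m) by apply pow_R1_Rle, HL1. nra. }
    unfold c. specialize (Hlpow n (d n)). specialize (Hhalf n).
    apply Rmult_le_reg_r with (l n ^ d n); [exact Hlpow |].
    replace ((1 / 2) ^ n * / l n ^ d n * l n ^ d m * l n ^ d n)
      with ((1 / 2) ^ n * l n ^ d m) by (field; lra).
    nra. }
  assert (Hsumd : forall m, ex_series (fun n => c n * l n ^ d m)).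
  { intros m.
    apply (ex_series_le (V := R_CompleteNormedModule))
      with (b := fun n => M (d m) * (1 / 2) ^ n).
    - intros n. change (Rabs (c n * l n ^ d m) <= M (d m) * (1 / 2) ^ n).
      rewrite Rabs_pos_eq by now apply exp_series_coef_pos. apply Hbound.
    - eexists. apply is_series_half_pow. }
  (* Order [k] is dominated by order [d k], since [k < d k] and [l n >= 1]. *)
  assert (Hsum : forall k, ex_series (fun n => c n * l n ^ k)).
  { intros k. apply (ex_series_le (V := R_CompleteNormedModule)) with (2 := Hsumd k).
    intros n. change (Rabs (c n * l n ^ k) <= c n * l n ^ d k).
    rewrite Rabs_pos_eq by now apply exp_series_coef_pos.
    apply Rmult_le_compat_l; [apply Hc |].
    apply Rle_pow; [apply Hl1 |]. specialize (Hge k). lia. }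
  exists d, (exp_series b c l 0).
  split; [intros n; specialize (Hge n); lia |].
  split; [exact Hinc |].
  split.
  { apply is_lim_seq_le_p_loc with (2 := is_lim_seq_INR).
    exists O. intros n _. apply le_INR. specialize (Hge n). lia. }
  split; [now apply smooth_on_exp_series |].
  split.
  (* The geometric series sums to [2 * M (d m)], and [2 <= 2 ^ (d m + 1)]. *)
  { exists 2. split; [lra |]. intros m.
    exists (Series (fun n => c n * l n ^ d m)).
    split; [now apply is_max_on_derive_n_exp_series |].
    apply Rle_trans with (M (d m) * 2).
    - rewrite <- (is_series_unique _ _ (is_series_half_pow (M (d m)))).
      apply Series_le; [| eexists; apply is_series_half_pow].
      intros n. split; [now apply exp_series_coef_pos | apply Hbound].
    - rewrite pow_add, pow_1. specialize (hM (d m)).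
      assert (H := pow_R1_Rle 2 (d m) ltac:(lra)). nra. }
  intros [_ [K [HK H]]].
  (* With [n > K], the single term of index [n] of the derivative of order [d n + 1] at [b] already
     violates the bound. *)
  destruct (INR_unbounded K) as [n Hn].
  assert (Hb : segment a b b) by (unfold segment; lra).
  specialize (H b (d n + 1)%nat Hb).
  rewrite derive_n_on_exp_series, exp_series_at_end in H by easy.
  assert (Hterm : c n * l n ^ (d n + 1) <= Series (fun j => c j * l j ^ (d n + 1))).
  { apply (Series_ge_term (fun j => c j * l j ^ (d n + 1))); [| apply Hsum].
    intros j. now apply exp_series_coef_pos. }
  (* The factor [/ l n ^ d n] of [c n] cancels all but one power of [l n]. *)
  replace (c n * l n ^ (d n + 1)) with ((1 / 2) ^ n * l n) in Hterm.
  2:{ unfold c. rewrite pow_add, pow_1. field.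
      apply Rgt_not_eq, Hlpow. }
  (* The class bound at order [d n + 1] carries the exponent [d n + 2], which is why the threshold
     has it. *)
  assert (HKM : K ^ (d n + 1 + 1) <= INR (n + 1) ^ (d n + 2)).
  { replace (d n + 1 + 1)%nat with (d n + 2)%nat by lia.
    apply pow_incr. rewrite plus_INR. simpl INR. lra. }
  specialize (hM (d n + 1)%nat). specialize (Hlbig n). specialize (Hhalf n).
  apply (Rmult_lt_compat_l _ _ _ Hhalf) in Hlbig.
  rewrite <- Rmult_assoc, <- Rpow_mult_distr in Hlbig.
  replace (1 / 2 * 2) with 1 in Hlbig by field.
  rewrite pow1, Rmult_1_l in Hlbig.
  assert (Habs := Rle_abs (Series (fun j => c j * l j ^ (d n + 1)))).
  nra.
Qed.
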